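(* Let $\mathbf F$ be a finite field of order $q$. Let $\varphi(m)$ be the number of pairwise nonisomorphic algebras of dimension $m$ over $\mathbf F$, and let $\psi(m)$ be the number of those of them which admit a nontrivial automorphism. Put $c=-\log_q\prod_{i=1}^{\infty}(1-q^{-i})>0$. Then $$\varphi(m)=q^{\,m^3-m^2+c-O(q^{-m})}\qquad (m\to\infty).$$ Moreover, $\psi(m)/\varphi(m)$ converges to $0$ exponentially fast as $m\to\infty$ (i.e. there are constants $K>0$ and $0<\theta<1$ with $\psi(m)/\varphi(m)\le K\theta^{m}$ for all $m\geq 1$ sufficiently large).
   Context: An algebra over a field $\mathbf F$ is a vector space over $\mathbf F$ with an arbitrary bilinear multiplication (not assumed associative, commutative or unital). Algebras are counted up to isomorphism of $\mathbf F$-algebras, and automorphisms are $\mathbf F$-linear multiplicative bijections. *)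

(* Defs.v *)
From HB Require Import structures.
From mathcomp Require Import all_boot all_order all_algebra.
From mathcomp Require Import all_classical all_reals all_analysis.

Set Implicit Arguments.
Unset Strict Implicit.
Unset Printing Implicit Defensive.

Import Order.TTheory GRing.Theory Num.Theory.
Import numFieldNormedType.Exports.

Local Open Scope classical_set_scope.
Local Open Scope ring_scope.

Record algebra (F : fieldType) := Algebra {
  alg_space :> vectType F;
  alg_mul : {bilinear alg_space -> alg_space -> alg_space}
}.

Arguments alg_mul {F} A : rename.

Definition alg_dim (F : fieldType) (A : algebra F) : nat := \dim {:A}.

Definition alg_iso (F : fieldType) (A B : algebra F) (f : {linear A -> B}) : Prop :=
  bijective f /\ {morph f : x y / alg_mul A x y >-> alg_mul B x y}.

Definition isomorphic (F : fieldType) (A B : algebra F) : Prop :=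
  exists f : {linear A -> B}, alg_iso f.

Definition has_nontrivial_aut (F : fieldType) (A : algebra F) : Prop :=
  exists f : {linear A -> A}, alg_iso f /\ exists x, f x <> x.

Definition represents_iso_classes (F : fieldType) (P : algebra F -> Prop)
    (n : nat) (A : 'I_n -> algebra F) : Prop :=
  [/\ forall i, P (A i),
      forall i j, isomorphic (A i) (A j) -> i = j &
      forall B, P B -> exists i, isomorphic (A i) B].

(* The algebras over [F] live in too large a universe to form a [set] of
   isomorphism classes, so that the number of classes satisfying [P] is the size
   of a system of representatives; it is 0 by default if there are infinitely
   many of them, which does not occur in bounded dimension over a finite
   field. *)
Definition nb_iso_classes (F : fieldType) (P : algebra F -> Prop) : nat :=
  xget 0%N [set n | exists A : 'I_n -> algebra F, represents_iso_classes P A].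

Definition phi (F : finFieldType) (m : nat) : nat :=
  nb_iso_classes (fun A : algebra F => alg_dim A = m).

Definition psi (F : finFieldType) (m : nat) : nat :=
  nb_iso_classes (fun A : algebra F => alg_dim A = m /\ has_nontrivial_aut A).

Definition logb (R : realType) (b x : R) : R := ln x / ln b.

Definition euler_prod (R : realType) (q : R) : R :=
  limn (fun n : nat => \prod_(1 <= i < n.+1) (1 - q ^- i)).

Definition alg_const (R : realType) (q : R) : R := - logb q (euler_prod q).

(* Main.v *)
Require Import Defs.
From HB Require Import structures.
From mathcomp Require Import all_boot all_order all_algebra all_fingroup.
From mathcomp Require Import all_classical all_reals all_analysis.
From mathcomp Require Import zify ring lra.

(* The isomorphism classes of algebras of dimension m are the orbits of
   GL_m(q) on the q^(m^3) bilinear multiplications on F^m, so that Burnside's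
   lemma gives phi(m) |GL_m(q)| = q^(m^3) + T, where T counts the pairs (g, x)
   with g <> 1 and x fixed by g; likewise psi(m) |GL_m(q)| <= 2 T.

   If g is not scalar, choose u such that v := g u is not a multiple of u, and a
   hyperplane W containing u but not v. A multiplication x fixed by g satisfies
   x (g w) (g w') = g (x w w'), and is determined by its restriction to W x W
   together with x v u: these give x w u for all w, hence x w v for all w, hence
   x w w' for all w in W, hence x v w'. A scalar g <> 1 fixes only 0. Thus g
   fixes at most q^(m ((m-1)^2 + 1)) multiplications, and summing over the at
   most q^(m^2) elements g yields T <= q^(m^3 - m) for m >= 3. The claims follow
   from |GL_m(q)| = q^(m^2) P_m with P_m := (1 - q^-1) ... (1 - q^-m), and
   P_m (1 - q^-m) <= P_oo <= P_m. *)

Set Implicit Arguments.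
Unset Strict Implicit.
Unset Printing Implicit Defensive.

Import Order.TTheory GRing.Theory Num.Theory.
Import numFieldNormedType.Exports.
Import VectorInternalTheory.

Local Open Scope ring_scope.

Lemma leq_card_bigcup (I T : finType) (P : pred I) (A : I -> {set T}) :
  (#|\bigcup_(i | P i) A i| <= \sum_(i | P i) #|A i|)%N.
Proof.
elim/big_rec2: _ => [|i k B _ leB]; first by rewrite cards0.
by apply: leq_trans (leq_card_setU _ _).1 _; rewrite leq_add2l.
Qed.

(** * Isomorphism of algebras and the counting of isomorphism classes *)

Section Isomorphism.
Variable F : fieldType.
Implicit Types (A B C : algebra F) (P : algebra F -> Prop).

Lemma alg_iso_inv A B (f : {linear A -> B}) : alg_iso f ->
  exists g : {linear B -> A}, [/\ alg_iso g, cancel f g & cancel g f].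
Proof.
move=> [[g fK gK] fM].
have g_lin : linear g by move=> a u v; apply: (can_inj fK); rewrite linearP !gK.
pose gL := GRing.isLinear.Build _ _ _ _ g g_lin.
pose g' : {linear B -> A} := HB.pack g gL.
exists g'; split=> //; split; first by exists f.
by move=> u v; apply: (can_inj fK); rewrite /= fM !gK.
Qed.

Lemma alg_iso_comp A B C (f : {linear A -> B}) (g : {linear B -> C}) :
  alg_iso f -> alg_iso g -> alg_iso (g \o f).
Proof.
move=> [fbij fM] [gbij gM]; split; first exact: bij_comp.
by move=> u v /=; rewrite fM gM.
Qed.

Lemma isomorphic_sym A B : isomorphic A B -> isomorphic B A.
Proof. by case=> f /alg_iso_inv[g [gP _ _]]; exists g. Qed.

Lemma isomorphic_trans A B C :
  isomorphic A B -> isomorphic B C -> isomorphic A C.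
Proof. by case=> f fP [g gP]; exists (g \o f); apply: alg_iso_comp. Qed.

Lemma isomorphic_nontrivial_aut A B :
  isomorphic A B -> has_nontrivial_aut A -> has_nontrivial_aut B.
Proof.
move=> [e eP] [f [fP [x fx]]]; have [g [gP eK gK]] := alg_iso_inv eP.
exists (e \o f \o g); split.
  by apply: alg_iso_comp gP _; apply: alg_iso_comp fP eP.
by exists (e x) => /=; rewrite eK => /(can_inj eK).
Qed.

Lemma represents_leq P n1 n2 (A1 : 'I_n1 -> algebra F) (A2 : 'I_n2 -> algebra F) :
  represents_iso_classes P A1 -> represents_iso_classes P A2 -> (n1 <= n2)%N.
Proof.
move=> [PA1 A1inj _] [_ _ A2sur].
have [h hP] := choice (fun i => A2sur (A1 i) (PA1 i)).
have h_inj : injective h.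
  move=> i j hij; apply: A1inj.
  by apply: isomorphic_trans (isomorphic_sym (hP i)) _; rewrite hij.
by have := leq_card h h_inj; rewrite !card_ord.
Qed.

(** Reduces the count to finite sets: [C] gives models of all classes and [k] is a complete
    invariant of the models. Choosing one [x] in [S] for each value of [k] yields a system of
    representatives, and any two systems have the same size by [represents_leq]. *)
Lemma nb_iso_classesE (X K : finType) (S : {set X}) (k : X -> K)
    (C : X -> algebra F) P :
    (forall x, x \in S -> P (C x)) ->
    (forall B, P B -> exists2 x, x \in S & isomorphic (C x) B) ->
    (forall x y, isomorphic (C x) (C y) <-> k x = k y) ->
  nb_iso_classes P = #|k @: S|.
Proof.
move=> PC Csur kP; set n := #|_|.
have ex i : exists x, x \in S /\ k x = enum_val (i : 'I_n).
  by have /imsetP[x Sx ->] := enum_valP i; exists x.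
have [s sP] := choice ex.
have sys : represents_iso_classes P (C \o s).
  split=> [i | i j /kP | B /Csur[x Sx xB]].
  - by apply: PC; case: (sP i).
  - by rewrite (sP i).2 (sP j).2 => /enum_val_inj.
  - have kx := imset_f k Sx; exists (enum_rank_in kx (k x)).
    apply: isomorphic_trans xB; apply/kP.
    by rewrite (sP _).2 enum_rankK_in.
apply: xget_unique; first by exists (C \o s).
move=> n' [A' sys']; apply/eqP; rewrite eqn_leq.
by rewrite (represents_leq sys' sys) (represents_leq sys sys').
Qed.

End Isomorphism.

(** * Multiplications on F^m given by structure constants *)

Section Structure.
Variables (F : fieldType) (m : nat).
Local Notation V := 'rV[F]_m.
Local Notation str := {ffun 'I_m * 'I_m -> V}.
Implicit Types (x y : str) (u v : V) (b : V -> V -> V).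

(* A structure [x] lists the products [x (i, j)] of the canonical basis vectors. *)
Definition smul x u v : V := \sum_p (u 0 p.1 * v 0 p.2) *: x p.

Lemma smul_linearl x v : linear (smul x ^~ v).
Proof.
move=> a u1 u2; rewrite scaler_sumr -big_split /=; apply: eq_bigr => p _.
by rewrite !mxE scalerA -scalerDl; congr (_ *: _); ring.
Qed.

Lemma smul_linearr x u : linear (smul x u).
Proof.
move=> a v1 v2; rewrite scaler_sumr -big_split /=; apply: eq_bigr => p _.
by rewrite !mxE scalerA -scalerDl; congr (_ *: _); ring.
Qed.

HB.instance Definition _ x := bilinear_isBilinear.Build F V V V *:%R *:%R
  (smul x) (smul_linearl x, smul_linearr x).

Definition str_of b : str := [ffun p => b (delta_mx 0 p.1) (delta_mx 0 p.2)].

Lemma smul_str_of_bilinear (b : {bilinear V -> V -> V}) : smul (str_of b) =2 b.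
Proof.
move=> u v; rewrite [in RHS](row_sum_delta u) [in RHS](row_sum_delta v).
rewrite linear_sumlz /smul; under [RHS]eq_bigr do rewrite linear_sumr.
by rewrite pair_bigA /=; apply: eq_bigr => p _; rewrite ffunE linearZlr /= scalerA.
Qed.

Lemma smul_str_of b : (forall v, linear (b^~ v)) -> (forall u, linear (b u)) ->
  smul (str_of b) =2 b.
Proof.
move=> bl br; pose bL := bilinear_isBilinear.Build F V V V *:%R *:%R b (bl, br).
pose b' : {bilinear V -> V -> V} := HB.pack b bL.
exact: (smul_str_of_bilinear b').
Qed.

Lemma smul_inj x y : smul x =2 smul y -> x = y.
Proof.
have strK z : z = str_of (smul z).
  apply/ffunP => -[i j]; rewrite ffunE /smul (bigD1 (i, j)) //= big1 ?addr0.
    by rewrite !mxE !eqxx mulr1 scale1r.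
  move=> [i' j'] /=; rewrite xpair_eqE !mxE !eqxx /= => /nandP[] /negbTE->.
    by rewrite mul0r scale0r.
  by rewrite mulr0 scale0r.
move=> xy; rewrite [x]strK [y]strK.
by apply/ffunP => p; rewrite !ffunE xy.
Qed.

Definition str_alg x : algebra F := @Algebra F V (smul x).

Lemma str_alg_dim x : alg_dim (str_alg x) = m.
Proof. by rewrite /alg_dim dimvf /dim /= mul1n. Qed.

End Structure.

Lemma str_alg_surj (F : fieldType) (B : algebra F) :
  exists x, isomorphic (@str_alg F (alg_dim B) x) B.
Proof.
rewrite /alg_dim dimvf.
pose b (u v : 'rV_(dim B)) := v2r (alg_mul B (r2v u) (r2v v)).
exists (str_of b), r2v; split; first by exists v2r; [exact: r2vK | exact: v2rK].
move=> u v /=; rewrite smul_str_of /b ?v2rK // => [w | w] a u1 u2.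
  by rewrite !linearP linearPl linearP.
by rewrite linearP linearPr linearP.
Qed.

(** * The action of GL on structures and its orbits *)

Section Action.
Variables (F : finFieldType) (n : nat).
Local Notation V := 'rV[F]_n.+1.
Local Notation str := {ffun 'I_n.+1 * 'I_n.+1 -> V}.
Local Notation GL := {'GL_n.+1[F]}.
Implicit Types (x y : str) (u v : V) (g h : GL).

(* A right action, since matrices act on row vectors on the right. *)
Definition act x g : str :=
  str_of (fun u v => smul x (u *m val g^-1%g) (v *m val g^-1%g) *m val g).

Lemma smul_act x g u v : smul (act x g) u v =
  smul x (u *m val g^-1%g) (v *m val g^-1%g) *m val g.
Proof.
rewrite smul_str_of // => [w | w] a u1 u2.
  by rewrite mulmxDl -scalemxAl linearPl mulmxDl -scalemxAl.
by rewrite mulmxDl -scalemxAl linearPr mulmxDl -scalemxAl.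
Qed.

Lemma GL_mulmxK g : val g *m val g^-1%g = 1%:M.
Proof. by rewrite -[LHS]/(val (g * g^-1)%g) mulgV. Qed.

Lemma GL_mulVmx g : val g^-1%g *m val g = 1%:M.
Proof. by rewrite -[LHS]/(val (g^-1 * g)%g) mulVg. Qed.

Lemma act1 x : act x 1%g = x.
Proof. by apply: smul_inj => u v; rewrite smul_act invg1 !mulmx1. Qed.

Lemma actM x g h : act x (g * h)%g = act (act x g) h.
Proof. by apply: smul_inj => u v; rewrite !smul_act invMg !mulmxA. Qed.

Canonical str_action := TotalAction act1 actM.

Lemma act_morph x y g :
  act x g = y <-> {morph mulmx^~ (val g) : u v / smul x u v >-> smul y u v}.
Proof.
split=> [<- u v | gM].
  by rewrite smul_act -!mulmxA GL_mulmxK !mulmx1.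
apply: smul_inj => u v; rewrite smul_act gM.
by rewrite -!mulmxA GL_mulVmx !mulmx1.
Qed.

Lemma act_alg_iso x y g : act x g = y <->
  alg_iso (mulmxr (val g) : {linear str_alg x -> str_alg y}).
Proof.
rewrite act_morph; split=> [gM | [_ gM]]; last exact: gM.
split; last exact: gM.
exists (mulmx^~ (val g^-1%g)) => u /=; rewrite -mulmxA.
  by rewrite GL_mulmxK mulmx1.
by rewrite GL_mulVmx mulmx1.
Qed.

(** The matrices of [f] and of its inverse multiply to the identity, so the matrix of [f] is a
    unit. *)
Lemma alg_iso_mulmx x y (f : {linear str_alg x -> str_alg y}) :
  alg_iso f -> exists g, f =1 mulmx^~ (val g).
Proof.
move=> fiso; have [f' [_ fK f'K]] := alg_iso_inv fiso.
have fE (u : V) : u *m lin1_mx f = f u := mul_rV_lin1 f u.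
have f'E (u : V) : u *m lin1_mx f' = f' u := mul_rV_lin1 f' u.
have ff' : lin1_mx f *m lin1_mx f' = 1%:M.
  by apply/row_matrixP => i; rewrite !rowE mulmxA fE f'E fK mulmx1.
have [unit_f _] := mulmx1_unit ff'.
exists (Sub (lin1_mx f) unit_f : GL) => u.
by rewrite SubK fE.
Qed.

Lemma isomorphic_str x y :
  isomorphic (str_alg x) (str_alg y) <-> exists g, act x g = y.
Proof.
split=> [[f fiso] | [g /act_alg_iso giso]]; last by exists (mulmxr (val g)).
have [g fE] := alg_iso_mulmx fiso; exists g; apply/act_morph => u v.
by rewrite -!fE; apply: fiso.2.
Qed.

Lemma nontrivial_aut_str x :
  has_nontrivial_aut (str_alg x) <-> exists2 g, g != 1%g & act x g = x.
Proof.
split=> [[f [fiso [u fu]]] | [g g1 /act_alg_iso giso]].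
  have [g fE] := alg_iso_mulmx fiso; exists g.
    by apply: contra_notN fu => /eqP g1; rewrite fE g1 mulmx1.
  by apply/act_morph => v w; rewrite -!fE; apply: fiso.2.
exists (mulmxr (val g)); split=> //.
apply: contrapT => /forallNP fix_g; case/eqP: g1; apply/val_inj/row_matrixP => i.
by rewrite !rowE mulmx1; apply: contrapT (fix_g _).
Qed.

Lemma isomorphic_orbit x y : isomorphic (str_alg x) (str_alg y) <->
  orbit str_action [set: GL] x = orbit str_action [set: GL] y.
Proof.
rewrite isomorphic_str; split=> [[g <-] | xy].
  by apply/esym/eqP; rewrite orbit_eq_mem; apply: mem_orbit; rewrite inE.
have /orbitP[g _ gx] : y \in orbit str_action [set: GL] x by rewrite xy orbit_refl.
by exists g.
Qed.

Lemma phi_orbits : phi F n.+1 = #|orbit str_action [set: GL] @: [set: str]|.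
Proof.
apply: (nb_iso_classesE (C := @str_alg F n.+1)) => [x _ | B dimB |].
- exact: str_alg_dim.
- by rewrite -dimB; have [x] := str_alg_surj B; exists x; rewrite ?inE.
- exact: isomorphic_orbit.
Qed.

Definition nonrigid : {set str} :=
  [set x | [exists g : GL, (g != 1%g) && (act x g == x)]].

Lemma nonrigidP x : reflect (has_nontrivial_aut (str_alg x)) (x \in nonrigid).
Proof.
rewrite inE; apply: (iffP existsP) => [[g /andP[g1 /eqP gx]] |].
  by apply/nontrivial_aut_str; exists g.
by case/nontrivial_aut_str => g g1 gx; exists g; rewrite g1 gx /=.
Qed.

Lemma psi_orbits : psi F n.+1 = #|orbit str_action [set: GL] @: nonrigid|.
Proof.
apply: (nb_iso_classesE (C := @str_alg F n.+1)) => [x /nonrigidP xaut | B [] |].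
- by split=> //; apply: str_alg_dim.
- move=> dimB Baut.
  have [x xB] : exists x, isomorphic (@str_alg F n.+1 x) B.
    by rewrite -dimB; apply: str_alg_surj.
  exists x => //; apply/nonrigidP.
  exact: isomorphic_nontrivial_aut (isomorphic_sym xB) Baut.
- exact: isomorphic_orbit.
Qed.

(** Burnside's lemma on [nonrigid] requires it to be a union of orbits. *)
Lemma acts_nonrigid : [acts [set: GL], on nonrigid | str_action].
Proof.
apply/actsP => g _ x; have xg : isomorphic (str_alg x) (str_alg (act x g)).
  by apply/isomorphic_str; exists g.
apply/nonrigidP/nonrigidP; apply: isomorphic_nontrivial_aut => //.
exact: isomorphic_sym.
Qed.

(** * Structures fixed by a nontrivial matrix *)

Lemma nonscalar_row (A : 'M[F]_n.+1) :
  ~~ is_scalar_mx A -> exists u : V, ~~ (u *m A <= u)%MS.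
Proof.
move=> A_nonscalar; apply: contrapT => /forallNP A_stable.
have {}A_stable (u : V) : exists a, u *m A = a *: u.
  by apply/sub_rVP/negPn/negP/A_stable.
have [a aP] := choice (fun i => A_stable (delta_mx 0 i)).
have a_const i j : a i = a j.
  have [-> // | neq_ij] := eqVneq i j.
  (* The sum of two basis vectors is also an eigenvector; its coordinates [i] and [j] show that both
     eigenvalues equal [c]. *)
  have [c] := A_stable (delta_mx 0 i + delta_mx 0 j).
  rewrite mulmxDl !aP => /rowP cP.
  have := cP i; have := cP j.
  rewrite !mxE !eqxx (negbTE neq_ij) eq_sym (negbTE neq_ij) /=.
  by rewrite !(mulr0, mulr1, addr0, add0r) => -> ->.
case/is_scalar_mxP: A_nonscalar; exists (a 0).
apply/row_matrixP => i; rewrite !rowE aP (a_const i 0).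
by rewrite mul_mx_scalar.
Qed.

Lemma hyperplane_separation (u v : V) : ~~ (v <= u)%MS ->
  exists W : 'M[F]_(n, n.+1), (u <= W)%MS /\
    forall w : V, exists a c, w = a *m W + c *: v.
Proof.
rewrite submxE => /rV0Pn[j vj].
(* [k] is a linear form vanishing at [u] but not at [v]; [W] will be a basis of its kernel. *)
pose k := col j (cokermx u).
have uk : u *m k = 0 by rewrite /k colE mulmxA mulmx_coker mul0mx.
have vk : (v *m k) 0 0 != 0 by rewrite /k colE mulmxA -colE mxE.
have k1 : \rank k = 1%N.
  rewrite -mxrank_tr rank_rV; case: eqVneq => // /(congr1 trmx).
  by rewrite trmxK trmx0 => k0; rewrite k0 mulmx0 mxE eqxx in vk.
have rk : \rank (kermx k) = n by rewrite mxrank_ker k1 subn1.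
(* A basis with exactly [n] rows is wanted, since the bound on fixed structures counts products of
   pairs of rows of [W]. *)
have [W WE] : exists W : 'M[F]_(n, n.+1), (W :=: kermx k)%MS.
  by move: (row_base (kermx k)) (eq_row_base (kermx k)); rewrite rk => W; exists W.
exists W; split=> [|w]; first by rewrite WE; apply/sub_kermxP.
pose c := (w *m k) 0 0 / (v *m k) 0 0.
have /submxP[a aW] : (w - c *: v <= W)%MS.
  rewrite WE; apply/sub_kermxP; rewrite mulmxBl -scalemxAl.
  rewrite [w *m k]mx11_scalar [v *m k]mx11_scalar scale_scalar_mx /c divfK //.
  exact: subrr.
by exists a, c; rewrite -aW subrK.
Qed.

Lemma fixed_eq g (u : V) (W : 'M[F]_(n, n.+1)) x y :
    (u <= W)%MS -> (forall w : V, exists a c, w = a *m W + c *: (u *m val g)) ->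
    act x g = x -> act y g = y ->
    (forall i j, smul x (row i W) (row j W) = smul y (row i W) (row j W)) ->
    smul x (u *m val g) u = smul y (u *m val g) u ->
  x = y.
Proof.
set v := u *m val g => uW Wv /act_morph xg /act_morph yg eqW eq_vu.
have eqWW a b : smul x (a *m W) (b *m W) = smul y (a *m W) (b *m W).
  rewrite (mulmx_sum_row a) (mulmx_sum_row b) !linear_sumlz; apply: eq_bigr => i _.
  by rewrite !linear_sumr; apply: eq_bigr => j _; rewrite !linearZlr /= eqW.
have [a0 uE] := submxP uW.
have eq_u w : smul x w u = smul y w u.
  have [a [c ->]] := Wv w; rewrite addrC !linearPl /= eq_vu.
  by rewrite uE eqWW.
have eq_g (w w' : V) : smul x w w' = smul y w w' ->
    smul x (w *m val g) (w' *m val g) = smul y (w *m val g) (w' *m val g).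
  by move=> eq_ww'; have /= <- := xg w w'; have /= <- := yg w w'; rewrite eq_ww'.
have gK (w : V) : w = (w *m val g^-1%g) *m val g by rewrite -mulmxA GL_mulVmx mulmx1.
(* Both [w] and [v] are images under [g], that of [v] being [u], so [eq_u] is transported by [g]. *)
have eq_v w : smul x w v = smul y w v by rewrite (gK w); apply: eq_g.
have eqWl a w : smul x (a *m W) w = smul y (a *m W) w.
  by have [b [c ->]] := Wv w; rewrite addrC !linearPr /= eq_v eqWW.
have eq_vl w : smul x v w = smul y v w.
  by rewrite (gK w); apply: eq_g; rewrite [u]uE eqWl.
apply: smul_inj => w w'; have [a [c ->]] := Wv w.
by rewrite addrC !linearPl /= eq_vl eqWl.
Qed.

Lemma card_str : #|{: str}| = (#|F| ^ (n.+1 * (n.+1 * n.+1)))%N.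
Proof. rewrite card_ffun card_prod !card_ord card_mx. by rewrite mul1n -expnM. Qed.

Lemma card_fix g :
  g != 1%g -> (#|'Fix_str_action[g]%g| <= #|F| ^ (n.+1 * (n * n).+1))%N.
Proof.
move=> g1; have [/is_scalar_mxP[a ga] | ] := boolP (is_scalar_mx (val g)).
  apply: (@leq_trans 1); last by rewrite expn_gt0 ltnW ?card_finNzRing_gt1.
  apply: leq_trans (eq_leq (cards1 (0 : str))).
  apply/subset_leq_card/fintype.subsetP => x.
  move=> /afix1P/act_morph xg; rewrite inE; apply/eqP/smul_inj => u v.
  have a0 : a != 0.
    apply: contraTneq (GL_unitmx g) => a0.
    by rewrite unitmxE ga a0 det_scalar expr0n unitr0.
  have a1 : a != 1.
    by apply: contraNneq g1 => a1; apply/eqP/val_inj; rewrite ga a1.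
  rewrite [RHS]big1 => [|p _]; last by rewrite ffunE scaler0.
  (* A product s of [x] satisfies a s = a^2 s, which forces s = 0 as [a] is neither 0 nor 1. *)
  have /= := xg u v; rewrite ga !mul_mx_scalar linearZlr /=.
  move/(scalerI a0)/eqP; rewrite -subr_eq0 -[X in X - _]scale1r -scalerBl.
  by rewrite scaler_eq0 subr_eq0 eq_sym (negbTE a1) => /eqP.
case/nonscalar_row => u /hyperplane_separation[W [uW Wv]].
(* [None] stands for the one extra product of [u *m val g] and [u], whence the exponent
   [(n * n).+1]. *)
pose res x : {ffun option ('I_n * 'I_n) -> V} := [ffun o =>
  if o is Some (i, j) then smul x (row i W) (row j W) else smul x (u *m val g) u].
rewrite (@leq_trans #|{ffun option ('I_n * 'I_n) -> V}|) //; last first.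
  by rewrite card_ffun card_option card_prod !card_ord card_mx mul1n -expnM.
rewrite -(card_in_imset (f := res)) ?max_card // => x y.
move=> /afix1P xg /afix1P yg /ffunP res_xy.
apply: fixed_eq uW Wv xg yg _ _ => [i j |].
  by have := res_xy (Some (i, j)); rewrite !ffunE.
by have := res_xy None; rewrite !ffunE.
Qed.

(** * Orbit counting by Burnside's lemma *)

Definition moved_fix : nat := \sum_(g : GL | g != 1%g) #|'Fix_str_action[g]%g|.

Lemma moved_fix_leq : (moved_fix <= #|F| ^ (n.+1 * n.+1 + n.+1 * (n * n).+1))%N.
Proof.
have le_fix : (moved_fix <= \sum_(g : GL | g != 1%g) #|F| ^ (n.+1 * (n * n).+1))%N.
  by apply: leq_sum => g; apply: card_fix.
apply: leq_trans le_fix _.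
rewrite sum_nat_const expnD leq_mul2r; apply/orP; right.
apply: leq_trans (max_card _) _; rewrite card_sub -card_mx.
exact: max_card.
Qed.

Lemma phi_burnside :
  (phi F n.+1 * #|'GL_n.+1[F]%g| = #|F| ^ (n.+1 * (n.+1 * n.+1)) + moved_fix)%N.
Proof.
rewrite phi_orbits -Frobenius_Cauchy; last first.
  by apply/actsP => g _ x; rewrite !inE.
rewrite (bigD1 1%g) ?inE //=; congr (_ + _)%N.
  rewrite -card_str -[RHS]cardsT; congr #|pred_of_set _|; apply/setP => x.
  by rewrite finset.in_setI !finset.in_setT; apply/afix1P/act1.
by apply: eq_big => [g | g _]; rewrite ?inE // finset.setTI.
Qed.

(** In Burnside's sum over [nonrigid], the identity contributes the size of [nonrigid], at most
    [moved_fix] because this set is covered by the fixed sets of the g different from 1. The other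
    elements contribute at most [moved_fix] again. *)
Lemma psi_burnside : (psi F n.+1 * #|'GL_n.+1[F]%g| <= 2 * moved_fix)%N.
Proof.
rewrite psi_orbits -Frobenius_Cauchy ?acts_nonrigid //.
rewrite (bigD1 1%g) ?inE //= mul2n -addnn leq_add //.
  apply: leq_trans (subset_leq_card (finset.subsetIl _ _)) _.
  have /subset_leq_card :
      nonrigid \subset \bigcup_(g | g != 1%g) 'Fix_str_action[g]%g.
    apply/fintype.subsetP => x; rewrite inE => /existsP[g /andP[g1 /eqP gx]].
    by apply/bigcupP; exists g => //; apply/afix1P.
  by move/leq_trans; apply; apply: leq_card_bigcup.
rewrite (eq_bigl (fun g => g != 1%g)) => [|g]; last by rewrite inE.
by apply: leq_sum => g _; apply/subset_leq_card/finset.subsetIr.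
Qed.

End Action.

(** Dimension 0 is included, since the final formula involves the logarithm of [phi F m] for every
    [m]. The invariant is therefore the set of isomorphic structures rather than an orbit, the
    action being set up in dimension [n.+1] only. *)
Lemma phi_gt0 (F : finFieldType) m : (0 < phi F m)%N.
Proof.
pose str := {ffun 'I_m * 'I_m -> 'rV[F]_m}.
pose k (x : str) := [set y : str | `[< isomorphic (str_alg x) (str_alg y) >]]%SET.
have -> : phi F m = #|k @: [set: str]%SET|.
  apply: (nb_iso_classesE (C := @str_alg F m)) => [x _ | B dimB | x y].
  - exact: str_alg_dim.
  - by rewrite -dimB; have [x] := str_alg_surj B; exists x; rewrite ?inE.
  split=> [xy | kxy].
    apply/setP => z; rewrite !inE; apply/asboolP/asboolP;
      apply: isomorphic_trans => //.
    exact: isomorphic_sym.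
  have : y \in k y.
    by rewrite inE; apply/asboolP; exists idfun; split=> //; exists id.
  by rewrite -kxy inE => /asboolP.
by rewrite card_gt0; apply/set0Pn; exists (k 0); apply: imset_f; rewrite inE.
Qed.

(** * Partial products of the Euler product and their rate of convergence *)

Section EulerProduct.
Variables (R : realType) (q : R).
Hypothesis q_ge2 : 2 <= q.

Definition partial_prod (m : nat) : R := \prod_(1 <= i < m.+1) (1 - q ^- i).
Local Notation P := partial_prod.

Let q_gt0 : 0 < q. Proof. by rewrite (lt_le_trans _ q_ge2). Qed.

Let qV_gt0 m : 0 < q ^- m. Proof. by rewrite invr_gt0 exprn_gt0. Qed.

Let qVS_le m : 2 * q ^- m.+1 <= q ^- m.
Proof.
rewrite exprS invfM mulrA -[leRHS]mul1r ler_pM2r // ler_pdivrMr // mul1r.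
exact: q_ge2.
Qed.

Let qV_le1 m : q ^- m <= 1.
Proof.
by rewrite invf_le1 ?exprn_gt0 // exprn_ege1 // (le_trans _ q_ge2) // ler1n.
Qed.

Let qVS_le_half m : q ^- m.+1 <= 2^-1.
Proof.
by have := le_trans (qVS_le m) (qV_le1 m); lra.
Qed.

Lemma partial_prodS m : P m.+1 = P m * (1 - q ^- m.+1).
Proof. by rewrite /P big_nat_recr. Qed.

Lemma partial_prod_gt0 m : 0 < P m.
Proof.
elim: m => [|m IHm]; first by rewrite /P big_geq.
rewrite partial_prodS mulr_gt0 // subr_gt0.
by have := qVS_le_half m; lra.
Qed.

(* The term [q ^- (m + k)] is only there to make the induction on [k] work. *)
Lemma partial_prod_lb m k : P m * (1 - q ^- m + q ^- (m + k)) <= P (m + k).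
Proof.
elim: k => [|k IHk]; first by rewrite addn0 subrK mulr1.
rewrite addnS partial_prodS.
have q1 : 0 <= 1 - q ^- (m + k).+1 by have := qVS_le_half (m + k); lra.
apply: le_trans (ler_wpM2r q1 IHk); rewrite -mulrA ler_pM2l ?partial_prod_gt0 //.
(* With a, b, d the inverse powers of exponents m, m + k, m + k + 1, it remains to see 1 - a + d <=
   (1 - a + b) (1 - d). The difference is (b - 2 d) + d (a - b), and both terms are nonnegative. *)
have qmk : q ^- (m + k) <= q ^- m.
  by rewrite exprD invfM -[leRHS]mulr1 ler_pM2l.
have := qVS_le (m + k); have := qV_gt0 (m + k).+1; have := qV_gt0 (m + k).
by have := qV_le1 m; nra.
Qed.

Lemma partial_prod_nonincreasing : nonincreasing_seq P.
Proof.
apply/nonincreasing_seqP => m; rewrite partial_prodS.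
rewrite -[leRHS]mulr1 ler_pM2l ?partial_prod_gt0 //.
by rewrite lerBlDr lerDl ltW.
Qed.

Lemma partial_prod_is_cvg : cvgn P.
Proof.
apply: nonincreasing_is_cvgn; first exact: partial_prod_nonincreasing.
by exists 0 => _ [m _ <-]; apply/ltW/partial_prod_gt0.
Qed.

Lemma euler_prod_le m : euler_prod q <= P m.
Proof.
exact: (nonincreasing_cvgn_ge partial_prod_nonincreasing partial_prod_is_cvg).
Qed.

Lemma euler_prod_ge m : P m * (1 - q ^- m) <= euler_prod q.
Proof.
apply: limr_ge; first exact: partial_prod_is_cvg.
exists m => // k /= le_mk; rewrite -(subnKC le_mk).
apply: le_trans (partial_prod_lb m (k - m)).
by rewrite ler_pM2l ?partial_prod_gt0 // lerDl ltW.
Qed.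

Lemma euler_prod_gt0 : 0 < euler_prod q.
Proof.
(* The lower bound vanishes at index 0, so index 1 is used. *)
apply: lt_le_trans (euler_prod_ge 1).
by rewrite mulr_gt0 ?partial_prod_gt0 //; have := qVS_le_half 0; lra.
Qed.

Lemma alg_const_gt0 : 0 < alg_const q.
Proof.
rewrite /alg_const /logb -mulNr divr_gt0 //; last first.
  by rewrite ln_gt0 // (lt_le_trans _ q_ge2) // ltr1n.
rewrite oppr_gt0 ln_lt0 // euler_prod_gt0 /=.
apply: le_lt_trans (euler_prod_le 1) _.
by rewrite /P big_nat1 ltrBlDr ltrDl.
Qed.

Lemma ln_partial_prod_euler m :
  0 <= ln (P m.+1) - ln (euler_prod q) <= 2 * q ^- m.+1.
Proof.
set t := q ^- m.+1; have t_half : t <= 2^-1 := qVS_le_half m.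
have t0 : 0 < t := qV_gt0 m.+1; have t1 : 0 < 1 - t by lra.
have P0 := partial_prod_gt0 m.+1.
apply/andP; split.
  by rewrite subr_ge0 ler_ln ?posrE ?euler_prod_gt0 ?euler_prod_le.
(* For 0 < t <= 1/2 the inverse of 1 - t is at most 1 + 2 t; the index [m.+1] ensures t <= 1/2. *)
have lnt : - ln (1 - t) <= 2 * t.
  rewrite -lnV ?posrE //; apply: le_trans (_ : ln (1 + 2 * t) <= _).
    rewrite ler_ln ?posrE ?invr_gt0 //; last by lra.
    by rewrite -div1r ler_pdivrMr //; nra.
  by apply: le_ln1Dx; lra.
apply: le_trans lnt; rewrite lerBlDr addrC -lerBlDr opprK -lnM ?posrE //.
by rewrite ler_ln ?posrE ?euler_prod_gt0 ?mulr_gt0 //; apply: euler_prod_ge.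
Qed.

End EulerProduct.

(** Passing from m to m + 1 multiplies the order of GL by q^m (q^(m+1) - 1) = q^(2m+1) (1 -
    q^-(m+1)), and 2m + 1 = (m+1)^2 - m^2. *)
Lemma card_GL_partial_prod (R : realType) (F : finFieldType) n (q := #|F|%:R : R) :
  #|'GL_n.+1[F]%g|%:R =
    q ^+ (n.+1 * n.+1) * partial_prod q n.+1.
Proof.
have q0 : q != 0 by rewrite pnatr_eq0 -lt0n ltnW // card_finNzRing_gt1.
rewrite card_GL // /partial_prod; elim: n.+1 => [|m IHm].
  by rewrite !big_geq // mulr1.
rewrite [in LHS]big_nat_recr //= [in RHS]big_nat_recr //=.
rewrite binS bin1 expnD mulnACA natrM IHm natrM natrX natrB; last first.
  by rewrite expn_gt0 ltnW // card_finNzRing_gt1.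
have -> : (m.+1 * m.+1 = m * m + (m + m.+1))%N by lia.
rewrite natrX -/q !exprD.
have : q ^+ m.+1 != 0 by rewrite expf_neq0.
move: (q ^+ m.+1) (q ^+ m) (q ^+ (m * m)) (\prod_(_ <= _ < _) _) => d b a X d0.
by field.
Qed.

(** * Estimates for the logarithm of phi and for the ratio psi / phi *)

Section Asymptotics.
Variables (R : realType) (F : finFieldType).
Local Notation q := (#|F|%:R : R).

Lemma card_field_ge2 : 2 <= q.
Proof. by rewrite ler_nat card_finNzRing_gt1. Qed.

Lemma moved_fix_small n : (1 < n)%N ->
  (moved_fix F n)%:R <= q ^+ (n.+1 * (n.+1 * n.+1)) * q ^- n.+1.
Proof.
move=> n_gt1; have q0 : 0 < q := lt_le_trans (ltr0Sn _ 1) card_field_ge2.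
rewrite ler_pdivlMr ?exprn_gt0 // -!natrX -natrM ler_nat.
apply: leq_trans (leq_mul (moved_fix_leq F n) (leqnn _)) _.
(* After division by n + 1, the exponents compare as n^2 + n + 3 <= n^2 + 2 n + 1, that is n >=
   2. *)
rewrite -expnD leq_exp2l; last exact: card_finNzRing_gt1.
nia.
Qed.

(** By Burnside's identity the difference is exactly ln (1 + T / q^(m^3)) with m = n + 1, which lies
    between 0 and T / q^(m^3). *)
Lemma ln_phi n : (1 < n)%N ->
  0 <= ln (phi F n.+1)%:R
       - ((n.+1%:R ^+ 3 - n.+1%:R ^+ 2) * ln q - ln (partial_prod q n.+1))
    <= q ^- n.+1.
Proof.
move=> n_gt1; have q2 := card_field_ge2.
have q0 : 0 < q := lt_le_trans (ltr0Sn _ 1) q2.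
have /(congr1 (fun k => k%:R : R)) := phi_burnside F n.
rewrite natrM natrD card_GL_partial_prod natrX.
have T0 : 0 <= (moved_fix F n)%:R :> R by rewrite ler0n.
have Tle := moved_fix_small n_gt1.
have phi0 : 0 < (phi F n.+1)%:R :> R by rewrite ltr0n phi_gt0.
have P0 := partial_prod_gt0 q2 n.+1.
set T := (moved_fix F n)%:R in T0 Tle *.
set Q3 := q ^+ (n.+1 * (n.+1 * n.+1)) in Tle *.
have Q30 : 0 < Q3 by rewrite exprn_gt0.
have TQ : 0 <= T / Q3 <= q ^- n.+1.
  by rewrite divr_ge0 ?(ltW Q30) //= ler_pdivrMr // mulrC.
have -> : Q3 + T = Q3 * (1 + T / Q3) by field; rewrite gt_eqF.
have T1 : 0 < 1 + T / Q3 by lra.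
move/(congr1 (@ln R)); rewrite !lnM ?posrE ?mulr_gt0 ?exprn_gt0 //.
have lnX k : ln (q ^+ k) = k%:R * ln q by rewrite lnXn // mulr_natl.
rewrite !lnX !natrM => lnE.
have /andP[TQ0 TQ1] := TQ.
have ln_ub : ln (1 + T / Q3) <= T / Q3 by apply: le_ln1Dx; lra.
have ln_lb : 0 <= ln (1 + T / Q3) by apply: ln_ge0; rewrite lerDl.
set m : R := n.+1%:R in lnE *.
have -> : ln (phi F n.+1)%:R - ((m ^+ 3 - m ^+ 2) * ln q - ln (partial_prod q n.+1))
    = ln (1 + T / Q3).
  by rewrite -(addrK (m * m * ln q + ln (partial_prod q n.+1)) (ln _)) lnE; ring.
by lra.
Qed.

(** Multiplying both counts by the order of GL bounds the ratio by 2 T / (q^(m^3) + T), where m = n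
    + 1. *)
Lemma psi_phi_ratio n : (1 < n)%N ->
  (psi F n.+1)%:R / (phi F n.+1)%:R <= 2 * q ^- n.+1.
Proof.
move=> n_gt1; have phi0 : 0 < (phi F n.+1)%:R :> R by rewrite ltr0n phi_gt0.
have GL0 : 0 < #|'GL_n.+1[F]%g|%:R :> R by rewrite ltr0n cardG_gt0.
rewrite ler_pdivrMr // -(ler_pM2r GL0) -mulrA -(natrM _ (phi F n.+1)) phi_burnside.
rewrite -natrM; apply: (le_trans (y := (2 * moved_fix F n)%:R)).
  by rewrite ler_nat psi_burnside.
rewrite natrM -mulrA ler_pM2l // natrD natrX mulrC.
apply: le_trans (moved_fix_small n_gt1) _.
by rewrite ler_wpM2r ?lerDl ?ler0n // invr_ge0 exprn_ge0 ?ler0n.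
Qed.

End Asymptotics.

Local Open Scope classical_set_scope.

Theorem theorem21 (R : realType) (F : finFieldType) :
  let q : R := #|F|%:R in
  let c : R := alg_const q in
  [/\ 0 < c,
      exists2 eps : nat -> R,
        eps =O_\oo (fun m : nat => q ^- m) &
        forall m : nat,
          (phi F m)%:R = q `^ (m%:R ^+ 3 - m%:R ^+ 2 + c - eps m)
    & exists K theta : R,
        [/\ 0 < K, 0 < theta < 1 &
            \forall m \near \oo,
              (psi F m)%:R / (phi F m)%:R <= K * theta ^+ m]].
Proof.
move=> q c; have q2 : 2 <= q := card_field_ge2 R F.
have q0 : 0 < q := lt_le_trans (ltr0Sn _ 1) q2.
have lnq0 : 0 < ln q by rewrite ln_gt0 // (lt_le_trans _ q2) // ltr1n.
split; first exact: alg_const_gt0.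
(* [eps] is obtained by solving the formula, which then holds for all [m]; only its decay needs
   proof. *)
- exists (fun m => m%:R ^+ 3 - m%:R ^+ 2 + c - logb q (phi F m)%:R); last first.
    move=> m; rewrite subKr /powR gt_eqF // /logb divfK ?gt_eqF //.
    by rewrite lnK // posrE ltr0n phi_gt0.
  (* The errors of [ln_phi] and [ln_partial_prod_euler] are at most 1 and 2 times q^-m; dividing by
     [ln q] passes to base q. Both bounds are available together from m = 3 on. *)
  apply/eqO_exP; exists (3 / ln q); first by rewrite divr_gt0.
  exists 3%N => // -[//|n] /= n_gt1.
  rewrite [in leRHS]ger0_norm; last by rewrite invr_ge0 exprn_ge0 // ltW.
  have /andP[phi_lb phi_ub] := ln_phi R F n_gt1.
  have /andP[P_lb P_ub] := ln_partial_prod_euler q2 n.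
  rewrite mulrAC ler_pdivlMr // -[X in _ * X]gtr0_norm // -normrM.
  rewrite /c /alg_const /logb mulrBl mulrDl mulNr !divfK ?gt_eqF //.
  by rewrite ler_norml; apply/andP; split; rewrite -/q in phi_lb phi_ub; lra.
- exists 2, q^-1; split=> //.
    by rewrite invr_gt0 q0 invf_lt1 // (lt_le_trans _ q2) // ltr1n.
  exists 3%N => // -[//|n] /= n_gt1; rewrite exprVn.
  exact: psi_phi_ratio.
Qed.
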